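(* Let $(M,h,\mathfrak{g}_\varphi,\nabla)$ be the real pseudo-Riemannian calculus over the noncommutative 3-sphere $S^3_\theta$ described in the context, with curvature operator $R$. Then $$R(\partial_1,\partial_2)E_1=-E_2|Z|^2,\quad R(\partial_1,\partial_2)E_2=E_1|W|^2,\quad R(\partial_1,\partial_2)E_3=0,$$ $$R(\partial_1,\partial_3)E_1=-E_3|Z|^2,\quad R(\partial_1,\partial_3)E_2=0,\quad R(\partial_1,\partial_3)E_3=E_1|Z|^2|W|^2,$$ $$R(\partial_2,\partial_3)E_1=0,\quad R(\partial_2,\partial_3)E_2=-E_3|W|^2,\quad R(\partial_2,\partial_3)E_3=E_2|Z|^2|W|^2.$$ Consequently the nonzero curvature components $R_{abpq}=h(E_a,R(\partial_p,\partial_q)E_b)$ are exactly those obtained, via the symmetries $R_{abpq}=-R_{abqp}=-R_{bapq}=R_{pqab}$, from $$R_{1212}=|Z|^2|W|^2,\qquad R_{1313}=(|Z|^2)^2|W|^2,\qquad R_{2323}=|Z|^2(|W|^2)^2.$$ Moreover, the scalar curvature exists, is unique, and is given by $S=6\cdot\mathbf{1}$; that is, there is a pseudo-inverse of $(h_{ab})$ with respect to which a scalar curvature exists, and any scalar curvature with respect to any pseudo-inverse of $(h_{ab})$ equals $6\cdot\mathbf{1}$.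
   Context: General definitions. $\mathcal{A}$ is a unital $*$-algebra over $\mathbb{C}$. A derivation $d$ of $\mathcal{A}$ is hermitian if $d(a^* )^*=d(a)$ for all $a$; an element $a$ is hermitian if $a^*=a$. A hermitian form on a right $\mathcal{A}$-module $M$ is a map $h:M\times M\to\mathcal{A}$ with $h(U,V+W)=h(U,V)+h(U,W)$, $h(U,Va)=h(U,V)a$, $h(U,V)^*=h(V,U)$; it is a metric if it is non-degenerate ($h(U,V)=0$ for all $V$ implies $U=0$). For a real Lie algebra $\mathfrak{g}$ of hermitian derivations, an affine connection on $(M,\mathfrak{g})$ is a map $\nabla:\mathfrak{g}\times M\to M$, additive in $M$, $\mathbb{R}$-linear in $\mathfrak{g}$, with $\nabla_d(Ua)=(\nabla_dU)a+Ud(a)$. Given a metric $h$ on $M$ and an $\mathbb{R}$-linear map $\varphi:\mathfrak{g}\to M$, write $\mathfrak{g}_\varphi=(\mathfrak{g},\varphi)$, $M_\varphi=\varphi(\mathfrak{g})$; $(M,h,\mathfrak{g}_\varphi)$ is a real metric calculus if $M_\varphi$ generates $M$ and $h(E,E')$ is hermitian for all $E,E'\in M_\varphi$. $(M,h,\mathfrak{g}_\varphi,\nabla)$ is a pseudo-Riemannian calculus if in addition $\nabla$ is an affine connection on $(M,\mathfrak{g})$ with: $h(\nabla_dE,E')$ hermitian for all $d\in\mathfrak{g}$, $E,E'\in M_\varphi$; $d(h(U,V))=h(\nabla_dU,V)+h(U,\nabla_dV)$ for all $d,U,V$; $\nabla_{d_1}\varphi(d_2)-\nabla_{d_2}\varphi(d_1)-\varphi([d_1,d_2])=0$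 for all $d_1,d_2\in\mathfrak{g}$. It is real if $h(\nabla_{d_1}\nabla_{d_2}E,E')$ is hermitian for all $d_1,d_2\in\mathfrak{g}$, $E,E'\in M_\varphi$. The curvature operator is $R(d_1,d_2)U=\nabla_{d_1}\nabla_{d_2}U-\nabla_{d_2}\nabla_{d_1}U-\nabla_{[d_1,d_2]}U$. Scalar curvature. For a basis $\partial_1,\dots,\partial_n$ of $\mathfrak{g}$, $E_a=\varphi(\partial_a)$, put $h_{ab}=h(E_a,E_b)$, $R_{abpq}=h(E_a,R(\partial_p,\partial_q)E_b)$. A pseudo-inverse of $h_{ab}$ is a pair $(\hat h^{ab},H)$ with $\hat h^{ab},H\in\mathcal{A}$, $H$ hermitian and regular (not a zero divisor), such that $\hat h^{ab}h_{bc}=h_{cb}\hat h^{ba}=\delta^a_cH$ (repeated indices summed). A scalar curvature with respect to $(\hat h^{ab},H)$ is an element $S\in\mathcal{A}$ with $\hat h^{ab}R_{apbq}\hat h^{pq}=HSH$. The calculus over $S^3_\theta$. Let $\theta\in\mathbb{R}$, $q=e^{2\pi i\theta}$. $S^3_\theta$ is the unital $*$-algebra over $\mathbb{C}$ generated by $Z,Z^*,W,W^*$ subject to $WZ=qZW$, $W^*Z=\bar qZW^*$, $WZ^*=\bar qZ^*W$, $W^*Z^*=qZ^*W^*$, $Z^*Z=ZZ^*$, $W^*W=WW^*$, $WW^*=\mathbf{1}-ZZ^*$. Set $|Z|^2=ZZ^*$, $|W|^2=WW^*$ (central elements), $X^1=\frac12(Z+Z^* )$, $X^2=\frac1{2i}(Z-Z^*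 )$, $X^3=\frac12(W+W^* )$, $X^4=\frac1{2i}(W-W^* )$. $M$ is the right submodule of $(S^3_\theta)^4$ generated by $E_1=(-X^2,X^1,0,0)$, $E_2=(0,0,-X^4,X^3)$, $E_3=(X^1|W|^2,X^2|W|^2,-X^3|Z|^2,-X^4|Z|^2)$; it is free with basis $E_1,E_2,E_3$. For $U=\sum_aE_aU^a$, $V=\sum_aE_aV^a$, $h(U,V)=\sum_{a,b=1}^3(U^a)^*h_{ab}V^b$ with $(h_{ab})=\mathrm{diag}(|Z|^2,|W|^2,|Z|^2|W|^2)$. $\partial_1,\partial_2,\partial_3$ are the (commuting) hermitian derivations determined by $\partial_1Z=iZ$, $\partial_1W=0$; $\partial_2Z=0$, $\partial_2W=iW$; $\partial_3Z=Z|W|^2$, $\partial_3W=-W|Z|^2$. $\mathfrak{g}$ is the (abelian) real Lie algebra generated by them, with basis $\partial_1,\partial_2,\partial_3$, and $\varphi$ is the $\mathbb{R}$-linear map with $\varphi(\partial_a)=E_a$. $\nabla$ is the unique affine connection making $(M,h,\mathfrak{g}_\varphi,\nabla)$ a real pseudo-Riemannian calculus; with $\nabla_a=\nabla_{\partial_a}$ it is given by $\nabla_1E_1=-E_3$, $\nabla_1E_2=0$, $\nabla_1E_3=E_1|W|^2$, $\nabla_2E_1=0$, $\nabla_2E_2=E_3$, $\nabla_2E_3=-E_2|Z|^2$, $\nabla_3E_1=E_1|W|^2$, $\nabla_3E_2=-E_2|Z|^2$, $\nabla_3E_3=E_3(|W|^2-|Z|^2)$. *)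

(* Defs.v *)
From HB Require Import structures.
From mathcomp Require Import all_boot all_order all_algebra complex.
From mathcomp Require Import all_classical all_reals all_analysis.
Set Implicit Arguments.
Unset Strict Implicit.
Unset Printing Implicit Defensive.
Import Order.TTheory GRing.Theory Num.Theory.
Local Open Scope classical_set_scope.
Local Open Scope ring_scope.

HB.mixin Record Algebra_hasStar (K : numClosedFieldType) A
    of GRing.Algebra K A := {
  star : A -> A;
  starK : involutive star;
  starD : {morph star : a b / a + b};
  starM : forall a b, star (a * b) = star b * star a;
  starZ : forall c a, star (c *: a) = c^* *: star a
}.

#[short(type="starAlgType")]
HB.structure Definition StarAlgebra (K : numClosedFieldType) :=
  {A of Algebra_hasStar K A & GRing.Algebra K A}.

(* A right A-module is an lmodType over the converse ring A^c: the right      *)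
(* action U a is the scaling of U by a seen in A^c.                           *)
Definition ract (A : nzRingType) (M : lmodType A^c) (U : M) (a : A) : M :=
  (a : A^c) *: U.
Notation "U <* a" := (ract U a) (at level 40, left associativity) : ring_scope.

Section Calculus.
Variables (R : realType) (A : starAlgType R[i]).

Definition hermitian (a : A) : Prop := star a = a.

Definition derivation (d : A -> A) : Prop :=
  linear d /\ forall a b, d (a * b) = d a * b + a * d b.

Definition hermitian_derivation (d : A -> A) : Prop :=
  derivation d /\ forall a, star (d (star a)) = d a.

Definition lie (d1 d2 : A -> A) : A -> A := fun a => d1 (d2 a) - d2 (d1 a).

Definition real_lie_algebra (g : set (A -> A)) : Prop :=
  [/\ forall d, g d -> hermitian_derivation d,
      g (fun=> 0),
      forall d1 d2, g d1 -> g d2 -> g (fun a => d1 a + d2 a),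
      forall (r : R) d, g d -> g (fun a => r%:C%C *: d a)
    & forall d1 d2, g d1 -> g d2 -> g (lie d1 d2)].

Definition lie_generated (D : set (A -> A)) : set (A -> A) :=
  [set d | forall g, real_lie_algebra g -> D `<=` g -> g d].

Variable M : lmodType A^c.

Definition rscale (r : R) (U : M) : M := U <* (r%:C%C)%:A.

Definition generates (D : set M) : Prop :=
  forall U : M, exists (n : nat) (E : 'I_n -> M) (u : 'I_n -> A),
    (forall i, D (E i)) /\ U = \sum_i E i <* u i.

Record hermitian_form (h : M -> M -> A) : Prop := HermitianForm {
  hform_addr : forall U V W, h U (V + W) = h U V + h U W;
  hform_ract : forall U V a, h U (V <* a) = h U V * a;
  hform_star : forall U V, star (h U V) = h V U
}.

Definition metric (h : M -> M -> A) : Prop :=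
  hermitian_form h /\ forall U, (forall V, h U V = 0) -> U = 0.

(* The maps g -> M and g x M -> M are represented by maps defined on all      *)
(* functions A -> A; only their values at elements of g are ever constrained  *)
(* or used.                                                                   *)
Variable g : set (A -> A).

Definition real_linear_on (phi : (A -> A) -> M) : Prop :=
  (forall d1 d2, g d1 -> g d2 -> phi (fun a => d1 a + d2 a) = phi d1 + phi d2)
  /\ (forall (r : R) d, g d -> phi (fun a => r%:C%C *: d a) = rscale r (phi d)).

Record affine_connection (nabla : (A -> A) -> M -> M) : Prop :=
  AffineConnection {
  conn_add : forall d U V, g d -> nabla d (U + V) = nabla d U + nabla d V;
  conn_linear : forall U, real_linear_on (nabla^~ U);
  conn_leibniz : forall d U a, g d ->
    nabla d (U <* a) = nabla d U <* a + U <* d a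
}.

Definition curvature (nabla : (A -> A) -> M -> M) (d1 d2 : A -> A) (U : M) :=
  nabla d1 (nabla d2 U) - nabla d2 (nabla d1 U) - nabla (lie d1 d2) U.

Variables (h : M -> M -> A) (phi : (A -> A) -> M).

Record real_metric_calculus : Prop := RealMetricCalculus {
  rmc_lie : real_lie_algebra g;
  rmc_metric : metric h;
  rmc_linear : real_linear_on phi;
  rmc_gen : generates (phi @` g);
  rmc_herm : forall E E', (phi @` g) E -> (phi @` g) E' -> hermitian (h E E')
}.

Record pseudo_Riemannian_calculus (nabla : (A -> A) -> M -> M) : Prop :=
  PseudoRiemannianCalculus {
  prc_rmc : real_metric_calculus;
  prc_conn : affine_connection nabla;
  prc_herm : forall d E E', g d -> (phi @` g) E -> (phi @` g) E' ->
    hermitian (h (nabla d E) E');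
  prc_compat : forall d U V, g d ->
    d (h U V) = h (nabla d U) V + h U (nabla d V);
  prc_torsion : forall d1 d2, g d1 -> g d2 ->
    nabla d1 (phi d2) - nabla d2 (phi d1) - phi (lie d1 d2) = 0
}.

Definition real_pseudo_Riemannian_calculus nabla : Prop :=
  pseudo_Riemannian_calculus nabla /\
  forall d1 d2 E E', g d1 -> g d2 -> (phi @` g) E -> (phi @` g) E' ->
    hermitian (h (nabla d1 (nabla d2 E)) E').

End Calculus.

Section ScalarCurvature.
Variables (R : realType) (A : starAlgType R[i]) (M : lmodType A^c).
Variables (h : M -> M -> A) (phi : (A -> A) -> M).
Variable nabla : (A -> A) -> M -> M.
Variables (n : nat) (d : 'I_n -> A -> A).

Definition metric_comp : 'M[A]_n := \matrix_(a, b) h (phi (d a)) (phi (d b)).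

Definition curv_comp (a b p q : 'I_n) : A :=
  h (phi (d a)) (curvature nabla (d p) (d q) (phi (d b))).

Definition pseudo_inverse (hinv : 'M[A]_n) (H : A) : Prop :=
  [/\ hermitian H, GRing.lreg H, GRing.rreg H,
      hinv *m metric_comp = H%:M & metric_comp *m hinv = H%:M].

Definition scalar_curvature (hinv : 'M[A]_n) (H S : A) : Prop :=
  \sum_a \sum_b \sum_p \sum_q hinv a b * curv_comp a p b q * hinv p q
  = H * S * H.

End ScalarCurvature.

(* Index quadruples reachable through                                         *)
(* R_{abpq} = - R_{abqp} = - R_{bapq} = R_{pqab}.                             *)
Inductive curv_sym (I : Type) (a b p q : I) : I -> I -> I -> I -> Prop :=
| curv_sym_refl : curv_sym a b p q a b p q
| curv_sym_r a' b' p' q' :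
    curv_sym a b p q a' b' p' q' -> curv_sym a b p q a' b' q' p'
| curv_sym_l a' b' p' q' :
    curv_sym a b p q a' b' p' q' -> curv_sym a b p q b' a' p' q'
| curv_sym_pair a' b' p' q' :
    curv_sym a b p q a' b' p' q' -> curv_sym a b p q p' q' a' b'.

(* S^3_theta, as the algebra presented by generators and relations: the       *)
(* quotient of formal noncommutative polynomials by the congruence generated  *)
(* by the axioms of unital C-algebras and the defining relations.  The term   *)
(* sC c stands for c times the unit.                                          *)
Inductive sterm (K : Type) : Type :=
| sZ | sZs | sW | sWs
| sC of K
| sadd of sterm K & sterm K
| smul of sterm K & sterm K.
Arguments sZ {K}. Arguments sZs {K}. Arguments sW {K}. Arguments sWs {K}.

HB.instance Definition _ (K : Type) := gen_eqMixin (sterm K).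
HB.instance Definition _ (K : Type) := gen_choiceMixin (sterm K).

Section Sphere.
Variables (R : realType) (theta : R).
Local Notation K := R[i].

Definition sq : K := (cos (2 * pi * theta) +i* sin (2 * pi * theta))%C.

Inductive seqv : sterm K -> sterm K -> Prop :=
| seqv_refl x : seqv x x
| seqv_sym x y : seqv x y -> seqv y x
| seqv_trans x y z : seqv x y -> seqv y z -> seqv x z
| seqv_add x x' y y' : seqv x x' -> seqv y y' -> seqv (sadd x y) (sadd x' y')
| seqv_mul x x' y y' : seqv x x' -> seqv y y' -> seqv (smul x y) (smul x' y')
| seqv_addA x y z : seqv (sadd x (sadd y z)) (sadd (sadd x y) z)
| seqv_addC x y : seqv (sadd x y) (sadd y x)
| seqv_add0 x : seqv (sadd (sC 0) x) x
| seqv_mulA x y z : seqv (smul x (smul y z)) (smul (smul x y) z)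
| seqv_mul1 x : seqv (smul (sC 1) x) x
| seqv_mul0 x : seqv (smul (sC 0) x) (sC 0)
| seqv_mulDl x y z : seqv (smul (sadd x y) z) (sadd (smul x z) (smul y z))
| seqv_mulDr x y z : seqv (smul x (sadd y z)) (sadd (smul x y) (smul x z))
| seqv_CD c d : seqv (sC (c + d)) (sadd (sC c) (sC d))
| seqv_CM c d : seqv (sC (c * d)) (smul (sC c) (sC d))
| seqv_Ccomm c x : seqv (smul (sC c) x) (smul x (sC c))
| seqv_WZ : seqv (smul sW sZ) (smul (sC sq) (smul sZ sW))
| seqv_WsZ : seqv (smul sWs sZ) (smul (sC sq^*) (smul sZ sWs))
| seqv_WZs : seqv (smul sW sZs) (smul (sC sq^*) (smul sZs sW))
| seqv_WsZs : seqv (smul sWs sZs) (smul (sC sq) (smul sZs sWs))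
| seqv_ZsZ : seqv (smul sZs sZ) (smul sZ sZs)
| seqv_WsW : seqv (smul sWs sW) (smul sW sWs)
| seqv_WWs : seqv (smul sW sWs)
    (sadd (sC 1) (smul (sC (-1)) (smul sZ sZs))).

Definition seqvb (x y : sterm K) : bool := `[< seqv x y >].

Lemma seqvb_equiv : equiv_class_of seqvb.
Proof.
split=> [x|x y|y x z]; first by apply/asboolP; exact: seqv_refl.
- by apply/asboolP/asboolP; exact: seqv_sym.
- by move=> /asboolP xy /asboolP yz; apply/asboolP; exact: seqv_trans xy yz.
Qed.

Canonical seqv_equiv := EquivRelPack seqvb_equiv.

Definition sphere3 : Type := {eq_quot seqvb}%qT.
HB.instance Definition _ := Choice.on sphere3.
HB.instance Definition _ := EqQuotient.on sphere3.

Definition spi (x : sterm K) : sphere3 := (\pi x)%qT.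

Lemma spiP x y : spi x = spi y <-> seqv x y.
Proof.
by split=> [/eqmodP/asboolP|xy] //; apply/eqmodP/asboolP.
Qed.

Lemma seqv_repr x : seqv (repr (spi x)) x.
Proof. by apply/spiP; rewrite /spi reprK. Qed.

Lemma spi_ind (P : sphere3 -> Prop) : (forall x, P (spi x)) -> forall a, P a.
Proof. by move=> PP a; rewrite -[a]reprK; exact: PP. Qed.

Definition s3add (a b : sphere3) : sphere3 := spi (sadd (repr a) (repr b)).
Definition s3mul (a b : sphere3) : sphere3 := spi (smul (repr a) (repr b)).
Definition s3scale (c : K) (a : sphere3) : sphere3 := spi (smul (sC c) (repr a)).
Definition s3opp (a : sphere3) : sphere3 := s3scale (-1) a.

Lemma spi_add x y : s3add (spi x) (spi y) = spi (sadd x y).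
Proof. by apply/spiP; apply: seqv_add; exact: seqv_repr. Qed.
Lemma spi_mul x y : s3mul (spi x) (spi y) = spi (smul x y).
Proof. by apply/spiP; apply: seqv_mul; exact: seqv_repr. Qed.
Lemma spi_scale c x : s3scale c (spi x) = spi (smul (sC c) x).
Proof. apply/spiP; apply: seqv_mul; [exact: seqv_refl|exact: seqv_repr]. Qed.

Lemma s3addA : associative s3add.
Proof.
elim/spi_ind=> x; elim/spi_ind=> y; elim/spi_ind=> z.
by rewrite !spi_add; apply/spiP; exact: seqv_addA.
Qed.
Lemma s3addC : commutative s3add.
Proof.
elim/spi_ind=> x; elim/spi_ind=> y.
by rewrite !spi_add; apply/spiP; exact: seqv_addC.
Qed.
Lemma s3add0 : left_id (spi (sC 0)) s3add.
Proof. by elim/spi_ind=> x; rewrite spi_add; apply/spiP; exact: seqv_add0. Qed.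
Lemma s3addN : left_inverse (spi (sC 0)) s3opp s3add.
Proof.
elim/spi_ind=> x; rewrite /s3opp spi_scale spi_add; apply/spiP.
apply: seqv_trans (seqv_mul0 x); rewrite -[0](addNr 1).
apply: seqv_trans (seqv_mul (seqv_sym (seqv_CD _ _)) (seqv_refl _)).
apply: seqv_trans (seqv_sym (seqv_mulDl _ _ _)).
by apply: seqv_add (seqv_refl _) (seqv_sym (seqv_mul1 x)).
Qed.
HB.instance Definition _ :=
  GRing.isZmodule.Build sphere3 s3addA s3addC s3add0 s3addN.

Lemma s3mulA : associative s3mul.
Proof.
elim/spi_ind=> x; elim/spi_ind=> y; elim/spi_ind=> z.
by rewrite !spi_mul; apply/spiP; exact: seqv_mulA.
Qed.
Lemma s3mul1l : left_id (spi (sC 1)) s3mul.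
Proof. by elim/spi_ind=> x; rewrite spi_mul; apply/spiP; exact: seqv_mul1. Qed.
Lemma s3mul1r : right_id (spi (sC 1)) s3mul.
Proof.
elim/spi_ind=> x; rewrite spi_mul; apply/spiP.
by apply: seqv_trans (seqv_mul1 x); exact: seqv_sym (seqv_Ccomm _ _).
Qed.
Lemma s3mulDl : left_distributive s3mul s3add.
Proof.
elim/spi_ind=> x; elim/spi_ind=> y; elim/spi_ind=> z.
by rewrite !(spi_add, spi_mul); apply/spiP; exact: seqv_mulDl.
Qed.
Lemma s3mulDr : right_distributive s3mul s3add.
Proof.
elim/spi_ind=> x; elim/spi_ind=> y; elim/spi_ind=> z.
by rewrite !(spi_add, spi_mul); apply/spiP; exact: seqv_mulDr.
Qed.

(* The character Z |-> 1, W |-> 0 shows that the algebra is not trivial.      *)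
Fixpoint schar (x : sterm K) : K :=
  match x with
  | sZ | sZs => 1
  | sW | sWs => 0
  | sC c => c
  | sadd x y => schar x + schar y
  | smul x y => schar x * schar y
  end.

Lemma schar_eqv x y : seqv x y -> schar x = schar y.
Proof.
elim=> //=.
- by move=> ? ? ? _ -> _ ->.
- by move=> ? ? ? ? _ -> _ ->.
- by move=> ? ? ? ? _ -> _ ->.
- by move=> *; rewrite addrA.
- by move=> *; rewrite addrC.
- by move=> *; rewrite add0r.
- by move=> *; rewrite mulrA.
- by move=> *; rewrite mul1r.
- by move=> *; rewrite mul0r.
- by move=> *; rewrite mulrDl.
- by move=> *; rewrite mulrDr.
- by move=> *; rewrite mulrC.
all: by rewrite ?(mulr0, mul0r, mulr1, subrr).
Qed.

Lemma s3oner0 : spi (sC 1) != spi (sC 0).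
Proof.
by apply/eqP => /spiP/schar_eqv /= /eqP; rewrite oner_eq0.
Qed.
HB.instance Definition _ := GRing.Zmodule_isNzRing.Build sphere3
  s3mulA s3mul1l s3mul1r s3mulDl s3mulDr s3oner0.

Lemma s3scaleA c d a : s3scale c (s3scale d a) = s3scale (c * d) a.
Proof.
elim/spi_ind: a => x; rewrite !spi_scale; apply/spiP.
apply: seqv_trans (seqv_mulA _ _ _) _.
exact: seqv_mul (seqv_sym (seqv_CM _ _)) (seqv_refl _).
Qed.
Lemma s3scale1 : left_id 1 s3scale.
Proof. by elim/spi_ind=> x; rewrite spi_scale; apply/spiP; exact: seqv_mul1. Qed.
Lemma s3scaleDr : right_distributive s3scale +%R.
Proof.
move=> c; elim/spi_ind=> x; elim/spi_ind=> y.
rewrite /GRing.add /= !(spi_scale, spi_add).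
by apply/spiP; exact: seqv_mulDr.
Qed.
Lemma s3scaleDl a : {morph s3scale^~ a : c d / c + d}.
Proof.
elim/spi_ind: a => x c d; rewrite /GRing.add /= !spi_scale spi_add.
apply/spiP; apply: seqv_trans (seqv_mulDl _ _ _).
exact: seqv_mul (seqv_CD _ _) (seqv_refl _).
Qed.
HB.instance Definition _ := GRing.Zmodule_isLmodule.Build K sphere3
  s3scaleA s3scale1 s3scaleDr s3scaleDl.

Lemma s3scaleAl (c : K) (a b : sphere3) : c *: (a * b) = c *: a * b.
Proof.
elim/spi_ind: a => x; elim/spi_ind: b => y.
rewrite /GRing.scale /GRing.mul /= !(spi_scale, spi_mul).
by apply/spiP; exact: seqv_mulA.
Qed.
HB.instance Definition _ := GRing.Lmodule_isLalgebra.Build K sphere3 s3scaleAl.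

Lemma s3scaleAr (c : K) (a b : sphere3) : c *: (a * b) = a * (c *: b).
Proof.
elim/spi_ind: a => x; elim/spi_ind: b => y.
rewrite /GRing.scale /GRing.mul /= !(spi_scale, spi_mul).
apply/spiP.
apply: seqv_trans (seqv_mulA _ _ _) _.
apply: seqv_trans (seqv_mul (seqv_Ccomm _ _) (seqv_refl _)) _.
exact: seqv_sym (seqv_mulA _ _ _).
Qed.
HB.instance Definition _ := GRing.Lalgebra_isAlgebra.Build K sphere3 s3scaleAr.

Fixpoint sstar (x : sterm K) : sterm K :=
  match x with
  | sZ => sZs | sZs => sZ
  | sW => sWs | sWs => sW
  | sC c => sC c^*
  | sadd x y => sadd (sstar x) (sstar y)
  | smul x y => smul (sstar y) (sstar x)
  end.

Lemma sstarK : involutive sstar.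
Proof. by elim=> //= [c|x -> y ->|x -> y ->] //; rewrite conjCK. Qed.

Lemma sq_unit : sq * sq^* = 1.
Proof.
rewrite /sq /Num.conj /=; simpc.
by rewrite -!expr2 cos2Dsin2 mulrC addNr.
Qed.

(* Adjoint of a relation x y = c y x, using that c has modulus one.           *)
Lemma sstar_rel (c : K) x y : c * c^* = 1 ->
  seqv (smul x y) (smul (sC c) (smul y x)) ->
  seqv (smul y x) (smul (smul x y) (sC c^*)).
Proof.
move=> cc xy.
apply: seqv_trans (seqv_Ccomm _ _).
apply: seqv_sym.
apply: seqv_trans (seqv_mul (seqv_refl _) xy) _.
apply: seqv_trans (seqv_mulA _ _ _) _.
apply: seqv_trans (seqv_mul (seqv_sym (seqv_CM _ _)) (seqv_refl _)) _.
by rewrite mulrC cc; exact: seqv_mul1.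
Qed.

Lemma sstar_eqv x y : seqv x y -> seqv (sstar x) (sstar y).
Proof.
elim=> /=.
- by move=> *; exact: seqv_refl.
- by move=> *; exact: seqv_sym.
- by move=> ? ? ? _ xy _; exact: seqv_trans.
- by move=> *; exact: seqv_add.
- by move=> *; exact: seqv_mul.
- by move=> *; exact: seqv_addA.
- by move=> *; exact: seqv_addC.
- by move=> *; rewrite rmorph0; exact: seqv_add0.
- by move=> *; apply: seqv_sym; exact: seqv_mulA.
- move=> *; rewrite rmorph1; apply: seqv_trans (seqv_mul1 _).
  exact: seqv_sym (seqv_Ccomm _ _).
- move=> z; rewrite rmorph0; apply: seqv_trans (seqv_mul0 (sstar z)).
  exact: seqv_sym (seqv_Ccomm _ _).
- by move=> *; exact: seqv_mulDr.
- by move=> *; exact: seqv_mulDl.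
- by move=> *; rewrite rmorphD; exact: seqv_CD.
- by move=> *; rewrite rmorphM mulrC; exact: seqv_CM.
- by move=> *; apply: seqv_sym; exact: seqv_Ccomm.
- by apply: sstar_rel seqv_WsZs; exact: sq_unit.
- by apply: sstar_rel seqv_WZs; rewrite conjCK mulrC sq_unit.
- by apply: sstar_rel seqv_WsZ; rewrite conjCK mulrC sq_unit.
- by apply: sstar_rel seqv_WZ; exact: sq_unit.
- exact: seqv_ZsZ.
- exact: seqv_WsW.
- rewrite rmorph1 rmorphN1; apply: seqv_trans seqv_WWs _.
  by apply: seqv_add (seqv_refl _) (seqv_Ccomm _ _).
Qed.

Definition s3star (a : sphere3) : sphere3 := spi (sstar (repr a)).

Lemma spi_star x : s3star (spi x) = spi (sstar x).
Proof. by apply/spiP; apply: sstar_eqv; exact: seqv_repr. Qed.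

Lemma s3starK : involutive s3star.
Proof. by elim/spi_ind=> x; rewrite !spi_star sstarK. Qed.
Lemma s3starD : {morph s3star : a b / a + b}.
Proof.
elim/spi_ind=> x; elim/spi_ind=> y.
by rewrite /GRing.add /= !(spi_add, spi_star).
Qed.
Lemma s3starM a b : s3star (a * b) = s3star b * s3star a.
Proof.
elim/spi_ind: a => x; elim/spi_ind: b => y.
by rewrite /GRing.mul /= !(spi_mul, spi_star).
Qed.
Lemma s3starZ c a : s3star (c *: a) = c^* *: s3star a.
Proof.
elim/spi_ind: a => x; rewrite /GRing.scale /= !(spi_scale, spi_star).
by apply/spiP; exact: seqv_sym (seqv_Ccomm _ _).
Qed.
HB.instance Definition _ := Algebra_hasStar.Build K sphere3
  s3starK s3starD s3starM s3starZ.

Definition Z : sphere3 := spi sZ.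
Definition W : sphere3 := spi sW.

Lemma star_Z : star Z = spi sZs. Proof. exact: spi_star. Qed.
Lemma star_W : star W = spi sWs. Proof. exact: spi_star. Qed.

Lemma spi_rel c x y z t : seqv (smul x y) (smul (sC c) (smul z t)) ->
  spi x * spi y = c *: (spi z * spi t).
Proof.
by rewrite /GRing.scale /GRing.mul /= !(spi_mul, spi_scale) => xy; apply/spiP.
Qed.

Lemma mulWZ : W * Z = sq *: (Z * W).
Proof. exact: spi_rel seqv_WZ. Qed.
Lemma mulWsZ : star W * Z = sq^* *: (Z * star W).
Proof. by rewrite star_W; exact: spi_rel seqv_WsZ. Qed.
Lemma mulWZs : W * star Z = sq^* *: (star Z * W).
Proof. by rewrite star_Z; exact: spi_rel seqv_WZs. Qed.
Lemma mulWsZs : star W * star Z = sq *: (star Z * star W).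
Proof. by rewrite star_W star_Z; exact: spi_rel seqv_WsZs. Qed.
Lemma mulZsZ : star Z * Z = Z * star Z.
Proof. by rewrite star_Z /GRing.mul /= !spi_mul; apply/spiP/seqv_ZsZ. Qed.
Lemma mulWsW : star W * W = W * star W.
Proof. by rewrite star_W /GRing.mul /= !spi_mul; apply/spiP/seqv_WsW. Qed.
Lemma mulWWs : W * star W = 1 - Z * star Z.
Proof.
rewrite star_W star_Z /GRing.opp /GRing.one /GRing.add /GRing.mul /=.
by rewrite /s3opp !spi_mul spi_scale spi_add; apply/spiP/seqv_WWs.
Qed.

Local Notation A := sphere3.

Definition nsq (a : A) : A := a * star a.

Definition X1 : A := 2^-1 *: (Z + star Z).
Definition X2 : A := (2 * 'i%C)^-1 *: (Z - star Z).
Definition X3 : A := 2^-1 *: (W + star W).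
Definition X4 : A := (2 * 'i%C)^-1 *: (W - star W).

(* 'rV[A^c]_4 is A^4 as a right A-module.                                     *)
Definition vec4 (a b c e : A) : 'rV[A^c]_4 :=
  \row_(j < 4) nth 0 [:: a; b; c; e] j.

Definition frame (a : 'I_3) : 'rV[A^c]_4 :=
  nth 0 [:: vec4 (- X2) X1 0 0;
            vec4 0 0 (- X4) X3;
            vec4 (X1 * nsq W) (X2 * nsq W) (- X3 * nsq Z) (- X4 * nsq Z)] a.

Definition in_frame_span : pred 'rV[A^c]_4 :=
  fun U => `[< exists u : 'I_3 -> A, U = \sum_a frame a <* u a >].

Lemma frame_span_submod : submod_closed in_frame_span.
Proof.
split=> [|a U V /asboolP[u ->] /asboolP[v ->]]; apply/asboolP.
  by exists (fun=> 0); rewrite big1 // => i _; rewrite /ract scale0r.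
exists (fun i => u i * a + v i).
rewrite scaler_sumr -big_split; apply: eq_bigr => i _ /=.
by rewrite /ract scalerA -scalerDl.
Qed.

HB.instance Definition _ :=
  GRing.isSubmodClosed.Build A^c 'rV[A^c]_4 in_frame_span frame_span_submod.

Definition sphere3_mod := {U : 'rV[A^c]_4 | in_frame_span U}.
HB.instance Definition _ := SubChoice.on sphere3_mod.
HB.instance Definition _ := [SubChoice_isSubLmodule of sphere3_mod by <:].

Lemma frame_in_span a : in_frame_span (frame a).
Proof.
apply/asboolP; exists (fun b => (b == a)%:R).
rewrite (bigD1 a) //= eqxx big1 ?addr0 => [|b /negPf->].
  by rewrite /ract scale1r.
by rewrite /ract scale0r.
Qed.

Definition E (a : 'I_3) : sphere3_mod := exist _ (frame a) (frame_in_span a).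

Definition hmx : 'M[A]_3 :=
  diag_mx (\row_(a < 3) nth 0 [:: nsq Z; nsq W; nsq Z * nsq W] a).

End Sphere.

Arguments Z {R theta}.
Arguments W {R theta}.
Arguments E {R theta}.
Arguments hmx {R theta}.

Definition ix1 : 'I_3 := @Ordinal 3 0 isT.
Definition ix2 : 'I_3 := @Ordinal 3 1 isT.
Definition ix3 : 'I_3 := @Ordinal 3 2 isT.

(* Main.v *)
Require Import Defs.
From HB Require Import structures.
From mathcomp Require Import all_boot all_order all_algebra complex.
From mathcomp Require Import all_classical all_reals all_analysis.
From mathcomp Require Import ring.
Set Implicit Arguments.
Unset Strict Implicit.
Unset Printing Implicit Defensive.
Import Order.TTheory GRing.Theory Num.Theory.
Local Open Scope classical_set_scope.
Local Open Scope ring_scope.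

(** Write z = |Z|^2, so that |W|^2 = 1 - z.  The element z is central, and
    everything in the statement with values in the algebra turns out to be a
    polynomial in z: the metric, the connection coefficients in the frame
    E_1, E_2, E_3, and their derivatives, since each derivation sends z to
    such a polynomial (to 0 for the first two and to 2 z (1 - z) for the
    third).  The differential geometry is thus that of a classical 3-sphere
    whose metric depends on one coordinate, and it is computed in K[t], K
    being the field of complex numbers, and transported by the morphism
    radial : p |-> p(z).

    The connection is determined by the hypotheses through the Koszul formula
    (frame_koszul): metric compatibility and vanishing torsion express
    2 h(E_k, nabla_a E_b) by derivatives of the metric, because hermiticity of
    h(nabla_a E_b, E_k) makes h symmetric on these pairs and because the
    derivations commute (lie_frame).  Non-degeneracy then gives nabla_a E_b
    itself (frame_connection).

    The curvature is that of a space of constant curvature one,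
    R(d_a, d_b) E_c = E_a h_bc - E_b h_ac (frame_curvature).  Hence
    R_abpq = h_ap h_qb - h_aq h_pb, from which the symmetries and the table of
    components follow.  Contracting twice with a pseudo-inverse replaces the
    metric by traces of H times the identity and gives (n^2 - n) H^2 = 6 H^2
    for n = 3 (constant_curvature_trace), so that H S H = H 6 H, and
    regularity of H yields S = 6.

    What remains uses the noncommutative algebra itself: p(z) has to be
    regular for p <> 0, both to exhibit a pseudo-inverse, with H = z (1 - z),
    and to know that the listed curvature components do not vanish.  The
    algebra is spanned over K[z] by the monomials Z^m W^n, (m, n) in Z^2,
    a negative power standing for a power of the adjoint (mono_span).  It acts
    on functions Z^2 -> K[t], Z and W acting as shifts twisted by powers of q
    and z as multiplication by t (act_eqv).  The delta function at the origin
    is sent by Z^m W^n p(z) to a nonzero multiple of p supported at (m, n)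
    (coef_mono).  So these monomials are independent over K[t], and p(z) a = 0
    forces a = 0 (radial_mul_eq0). *)

(** * Double contraction of a curvature tensor of constant curvature *)

Section ConstantCurvature.
Variables (A : nzRingType) (n : nat) (g ginv : 'M[A]_n) (H : A).
Hypothesis g_central : forall i j a, GRing.comm (g i j) a.
Hypothesis g_sym : forall i j, g i j = g j i.
Hypothesis ginvg : ginv *m g = H%:M.
Hypothesis gginv : g *m ginv = H%:M.

Lemma trace_sum (M N : 'M[A]_n) :
  M *m N = H%:M -> \sum_i \sum_j M i j * N j i = H *+ n.
Proof.
move=> MN; have <- : \tr (M *m N) = H *+ n by rewrite MN mxtrace_scalar.
by apply: eq_bigr => i _; rewrite mxE.
Qed.

(** The first product contracts to tr(ginv g) tr(g ginv) = (n H)^2.  In the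
    second, centrality of the g i j lets the sum over b be done first, leaving
    H tr(g ginv) = n H^2. *)
Lemma constant_curvature_trace :
  \sum_a \sum_b \sum_p \sum_q
     ginv a b * (g a b * g q p - g a q * g b p) * ginv p q
  = (H * H) *+ (n * n.-1).
Proof.
have -> : (n * n.-1 = n * n - n)%N by rewrite -subn1 mulnBr muln1.
rewrite mulrnBr; last by case: (n) => // m; exact: leq_pmulr.
have <- : (\sum_a \sum_b ginv a b * g b a) * (\sum_p \sum_q g q p * ginv p q) =
    (H * H) *+ (n * n).
  by rewrite [X in _ * X]exchange_big /= !trace_sum// mulrnAl mulrnAr -mulrnA.
have <- : \sum_a \sum_b \sum_p \sum_q ginv a b * (g a q * g b p) * ginv p q =
    (H * H) *+ n.
  transitivity (\sum_a \sum_p (ginv *m g) a p * \sum_q g q a * ginv p q).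
    apply: eq_bigr => a _; rewrite exchange_big; apply: eq_bigr => p _ /=.
    rewrite mxE mulr_suml; apply: eq_bigr => b _; rewrite mulr_sumr.
    apply: eq_bigr => q _.
    by rewrite (g_central a q) (g_sym a q) !mulrA.
  rewrite ginvg -[RHS]mulrnAr -(trace_sum gginv) [in RHS]exchange_big mulr_sumr.
  apply: eq_bigr => a _; rewrite (bigD1 a)//= [X in _ + X]big1 => [|p pa].
    by rewrite mxE eqxx addr0.
  by rewrite mxE eq_sym (negPf pa) mul0r.
rewrite mulr_suml -sumrB; apply: eq_bigr => a _.
rewrite mulr_suml -sumrB; apply: eq_bigr => b _.
rewrite mulr_sumr -sumrB; apply: eq_bigr => p _.
rewrite mulr_sumr -sumrB; apply: eq_bigr => q _.
by rewrite mulrBr mulrBl (g_sym b a) !mulrA.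
Qed.

End ConstantCurvature.

(** * Right modules, star algebras and hermitian derivations *)

Section RightModule.
Variables (A : nzRingType) (M : lmodType A^c).
Implicit Types (U V : M) (a b : A).

Lemma ractDr U a b : U <* (a + b) = U <* a + U <* b.
Proof. exact: scalerDl. Qed.
Lemma ractA U a b : U <* a <* b = U <* (a * b).
Proof. exact: scalerA. Qed.
Lemma ract0 U : U <* 0 = 0. Proof. exact: scale0r. Qed.
Lemma ract1 U : U <* 1 = U. Proof. exact: scale1r. Qed.
Lemma ractN U a : U <* (- a) = - (U <* a). Proof. exact: scaleNr. Qed.
Lemma ractB U a b : U <* (a - b) = U <* a - U <* b.
Proof. exact: scalerBl. Qed.
Lemma ract_suml I (s : seq I) (U : I -> M) a :
  (\sum_(i <- s) U i) <* a = \sum_(i <- s) U i <* a.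
Proof. exact: scaler_sumr. Qed.
Lemma ract_sumr I (s : seq I) U (a : I -> A) :
  U <* (\sum_(i <- s) a i) = \sum_(i <- s) U <* a i.
Proof. exact: scaler_suml. Qed.

End RightModule.

Section StarAlgebra.
Variables (R : realType) (A : starAlgType R[i]).

Lemma star0 : star (0 : A) = 0.
Proof. by have := starZ 0 (0 : A); rewrite !scale0r rmorph0 scale0r. Qed.
Lemma starN (a : A) : star (- a) = - star a.
Proof. by rewrite -scaleN1r starZ rmorphN1 scaleN1r. Qed.
Lemma starB (a b : A) : star (a - b) = star a - star b.
Proof. by rewrite starD starN. Qed.

Lemma star_nat (n : nat) : star (n%:R : A) = n%:R.
Proof.
have star1 : star (1 : A) = 1.
  by rewrite -[LHS]mul1r -{1}(starK 1) -starM mul1r starK.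
by rewrite -(scaler_nat n 1) starZ rmorph_nat star1.
Qed.

Variable d : A -> A.
Hypothesis dH : hermitian_derivation d.

Lemma derD a b : d (a + b) = d a + d b.
Proof. by have := dH.1.1 1 a b; rewrite !scale1r. Qed.
Lemma der0 : d 0 = 0.
Proof. by apply: (addrI (d 0)); rewrite -derD !addr0. Qed.
Lemma derZ c a : d (c *: a) = c *: d a.
Proof. by have := dH.1.1 c a 0; rewrite der0 !addr0. Qed.
Lemma derN a : d (- a) = - d a.
Proof. by rewrite -scaleN1r derZ scaleN1r. Qed.
Lemma derB a b : d (a - b) = d a - d b.
Proof. by rewrite derD derN. Qed.
Lemma derM a b : d (a * b) = d a * b + a * d b.
Proof. exact: dH.1.2. Qed.
Lemma der1 : d 1 = 0.
Proof.
by apply: (addrI (d 1)); rewrite addr0 -[in RHS](mulr1 1) derM mulr1 mul1r.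
Qed.
Lemma der_star a : d (star a) = star (d a).
Proof. by rewrite -(dH.2 a) starK. Qed.

Lemma der_horner_alg z v p : d z = v -> (forall a, GRing.comm z a) ->
  d (horner_alg z p) = horner_alg z p^`() * v.
Proof.
move=> dz zC; elim/poly_ind: p => [|p c IHp].
  by rewrite deriv0 !rmorph0 mul0r der0.
rewrite !poly.derivE rmorphD rmorphM /= horner_algX horner_algC.
rewrite derD derM IHp dz.
rewrite derZ der1 scaler0 addr0 rmorphD rmorphM /= horner_algX.
by rewrite mulrDl -!mulrA (zC v) addrC.
Qed.

End StarAlgebra.

(** * The geometry of the frame in polynomial form *)

Lemma ord3_ind (Q : 'I_3 -> Prop) :
  Q ix1 -> Q ix2 -> Q ix3 -> forall i, Q i.
Proof.
move=> Q1 Q2 Q3 [[|[|[|//]]] Hi].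
- by rewrite (_ : Ordinal Hi = ix1)//; exact: val_inj.
- by rewrite (_ : Ordinal Hi = ix2)//; exact: val_inj.
- by rewrite (_ : Ordinal Hi = ix3)//; exact: val_inj.
Qed.

Section Polynomials.
Variable K : fieldType.
Implicit Types a b c k : 'I_3.

(** Below, the variable stands for |Z|^2; this is the matrix (h_ab). *)
Definition metric_poly a b : {poly K} :=
  (nth 0 [:: 'X; 1 - 'X; 'X * (1 - 'X)] a) *+ (a == b).

(** The derivative of |Z|^2 along the a-th derivation, so that this derivation
    acts on polynomials in |Z|^2 as p |-> p' * frame_speed a. *)
Definition frame_speed a : {poly K} :=
  nth 0 [:: 0; 0; 2%:R * ('X * (1 - 'X))] a.

(** The coefficient of E_k in nabla_a E_b. *)
Definition christoffel a b k : {poly K} :=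
  match nat_of_ord a, nat_of_ord b, nat_of_ord k with
  | 0, 0, 2 => -1
  | 1, 1, 2 => 1
  | 0, 2, 0 | 2, 0, 0 => 1 - 'X
  | 1, 2, 1 | 2, 1, 1 => - 'X
  | 2, 2, 2 => 1 - 'X - 'X
  | _, _, _ => 0
  end.

Lemma metric_polyC a b : metric_poly a b = metric_poly b a.
Proof.
by rewrite /metric_poly eq_sym; case: eqVneq => [->//|_]; rewrite !mulr0n.
Qed.

(** The Koszul formula for an orthogonal frame of commuting derivations. *)
Lemma koszul a b k :
  (metric_poly b k)^`() * frame_speed a + (metric_poly a k)^`() * frame_speed b
    - (metric_poly a b)^`() * frame_speed k
  = 2%:R * (metric_poly k k * christoffel a b k).
Proof.
elim/ord3_ind: a; elim/ord3_ind: b; elim/ord3_ind: k;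
  rewrite /frame_speed /metric_poly /christoffel /= ?eqxx ?mulr1n ?mulr0n
    ?poly.derivE; ring.
Qed.

(** The coefficient of E_k in R(d_a, d_b) E_c when d_a and d_b commute. *)
Definition riemann_poly a b c k : {poly K} :=
  (christoffel b c k)^`() * frame_speed a +
    \sum_l christoffel a l k * christoffel b c l -
  ((christoffel a c k)^`() * frame_speed b +
    \sum_l christoffel b l k * christoffel a c l).

(** These are the coefficients of E_a h_bc - E_b h_ac, the curvature of the round
    unit sphere. *)
Lemma riemann_constant a b c k :
  riemann_poly a b c k =
  (a == k)%:R * metric_poly b c - (b == k)%:R * metric_poly a c.
Proof.
rewrite /riemann_poly !big_ord_recl !big_ord0.
have -> : lift ord0 (lift ord0 ord0) = ix3 :> 'I_3 by exact: val_inj.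
have -> : lift ord0 ord0 = ix2 :> 'I_3 by exact: val_inj.
have -> : ord0 = ix1 :> 'I_3 by exact: val_inj.
elim/ord3_ind: a; elim/ord3_ind: b; elim/ord3_ind: c; elim/ord3_ind: k;
  rewrite /frame_speed /metric_poly /christoffel /= ?eqxx ?mulr1n ?mulr0n
    ?poly.derivE; ring.
Qed.

(** The component R_abpq of a metric of constant curvature one. *)
Definition riemann_comp a b p q : {poly K} :=
  metric_poly a p * metric_poly q b - metric_poly a q * metric_poly p b.

(** A component with a = b or p = q cancels, and one whose pairs {a, b} and
    {p, q} differ has a vanishing factor in each product, because the metric is
    diagonal. *)
Lemma riemann_comp_support a b p q : riemann_comp a b p q != 0 ->
  curv_sym ix1 ix2 ix1 ix2 a b p q \/
  curv_sym ix1 ix3 ix1 ix3 a b p q \/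
  curv_sym ix2 ix3 ix2 ix3 a b p q.
Proof.
have swap (i j a' b' p' q' : 'I_3) : [|| (a', b', p', q') == (i, j, i, j),
    (a', b', p', q') == (i, j, j, i), (a', b', p', q') == (j, i, i, j)
    | (a', b', p', q') == (j, i, j, i)] -> curv_sym i j i j a' b' p' q'.
  have r := curv_sym_refl i j i j.
  by case/or4P => /eqP[-> -> -> ->] //; [exact: curv_sym_r|exact: curv_sym_l|
    exact/curv_sym_l/curv_sym_r].
elim/ord3_ind: a; elim/ord3_ind: b; elim/ord3_ind: p; elim/ord3_ind: q;
  first [ by left; apply: swap | by right; left; apply: swap
  | by right; right; apply: swap
  | by rewrite /riemann_comp /metric_poly /= ?mulr0n ?(mul0r, mulr0) ?subrr
      ?eqxx ].
Qed.

Lemma oneBX_neq0 : 1 - 'X != 0 :> {poly K}.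
Proof.
rewrite subr_eq0 eq_sym; apply/eqP => /(congr1 (horner^~ 0)) /eqP.
by rewrite hornerX hornerC eq_sym oner_eq0.
Qed.

End Polynomials.

(** * Generators, central elements and spanning monomials *)

Section SphereAlgebra.
Variables (R : realType) (theta : R).
Local Notation K := R[i].
Local Notation A := (sphere3 theta).
Local Notation q := (sq theta).
Local Notation spi := (spi theta).
Local Notation radial := (horner_alg (nsq (Z : A))).

Lemma spiD x y : spi (sadd x y) = spi x + spi y :> A.
Proof. by rewrite -spi_add. Qed.

Lemma spiM x y : spi (smul x y) = spi x * spi y :> A.
Proof. by rewrite -spi_mul. Qed.

Lemma spiC c : spi (sC c) = c%:A :> A.
Proof.
transitivity (s3scale c (spi (sC 1))); last by [].
rewrite spi_scale; apply/spiP; apply: seqv_sym.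
exact: seqv_trans (seqv_Ccomm _ _ _) (seqv_mul1 _ _).
Qed.

Lemma sphere_ind (Q : A -> Prop) :
  Q Z -> Q (star Z) -> Q W -> Q (star W) -> (forall c, Q c%:A) ->
  (forall a b, Q a -> Q b -> Q (a + b)) ->
  (forall a b, Q a -> Q b -> Q (a * b)) -> forall a, Q a.
Proof.
rewrite star_Z star_W => QZ QZs QW QWs QC QD QM.
elim/spi_ind; elim=> // [c|x Qx y Qy|x Qx y Qy].
- by rewrite spiC.
- by rewrite spiD; exact: QD.
- by rewrite spiM; exact: QM.
Qed.

Lemma central_of_generators (a : A) :
  GRing.comm a Z -> GRing.comm a (star Z) -> GRing.comm a W ->
  GRing.comm a (star W) -> forall b, GRing.comm a b.
Proof.
move=> aZ aZs aW aWs; elim/sphere_ind => // [c|b c ab ac|b c ab ac].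
- by rewrite /GRing.comm -scalerAr -scalerAl mulr1 mul1r.
- exact: commrD.
- exact: commrM.
Qed.

Lemma sq_neq0 : q != 0.
Proof.
apply/eqP=> q0; have /eqP := sq_unit theta.
by rewrite q0 mul0r eq_sym oner_eq0.
Qed.

Lemma sqV : q^* = q^-1.
Proof. by apply: (mulfI sq_neq0); rewrite sq_unit divff// sq_neq0. Qed.

Lemma nsqZ_central (b : A) : GRing.comm (nsq Z) b.
Proof.
move: b; apply: central_of_generators; rewrite /GRing.comm /nsq.
- by rewrite -mulrA mulZsZ.
- by rewrite mulrA mulZsZ.
- rewrite [RHS]mulrA mulWZ -scalerAl -[Z * W * _]mulrA mulWZs -scalerAr scalerA.
  by rewrite sq_unit scale1r mulrA.
- rewrite [RHS]mulrA mulWsZ -scalerAl -[Z * _ * star Z]mulrA mulWsZs -scalerAr.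
  by rewrite scalerA mulrC sq_unit scale1r mulrA.
Qed.

Lemma nsqW_sphere : nsq W = 1 - nsq Z :> A.
Proof. exact: mulWWs. Qed.

Lemma radialX : radial 'X = nsq Z. Proof. exact: horner_algX. Qed.
Lemma radial1X : radial (1 - 'X) = nsq W.
Proof. by rewrite rmorphB rmorph1 /= radialX nsqW_sphere. Qed.

Lemma radial_central p (b : A) : GRing.comm (radial p) b.
Proof.
elim/poly_ind: p => [|p c IHp].
  by rewrite rmorph0 /GRing.comm mul0r mulr0.
rewrite rmorphD rmorphM /= radialX horner_algC.
apply: commr_sym; apply: commrD.
  by apply: commrM; apply: commr_sym => //; exact: nsqZ_central.
by rewrite /GRing.comm -scalerAr -scalerAl mulr1 mul1r.
Qed.

(** Integer powers, the adjoint playing the part of the inverse.  For x = Z or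
    x = W, where x star x is a polynomial in |Z|^2, the rule x x^m = x^(m + 1)
    then holds up to such a polynomial. *)
Definition spow (x : A) (m : int) : A :=
  match m with Posz k => x ^+ k | Negz k => star x ^+ k.+1 end.

Lemma spow_star x m : spow (star x) (- m) = spow x m.
Proof.
by case: m => [[|k]|k] //; rewrite -NegzE /= starK.
Qed.

(** Raising a negative power cancels one factor star x against x. *)
Lemma mul_spow x s (m : int) :
  star x * x = x * star x -> x * star x = radial s ->
  exists p, x * spow x m = spow x (m + 1) * radial p.
Proof.
move=> xx xs; case: m => k.
  by exists 1; rewrite rmorph1 mulr1 -PoszD addn1 /= -exprS.
exists s; have -> : Negz k + 1 = - k%:Z.
  by rewrite NegzE -addn1 PoszD opprD addrNK.
rewrite -[x in spow x (- _)]starK spow_star /= exprS mulrA xs.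
exact: radial_central.
Qed.

Lemma mul_spow_star x s (m : int) : star x * x = x * star x ->
  x * star x = radial s ->
  exists p, star x * spow x m = spow x (m - 1) * radial p.
Proof.
move=> xx xs; rewrite -spow_star.
have [||p ->] := @mul_spow (star x) s (- m); rewrite ?starK ?xx//.
by exists p; rewrite -(spow_star x (m - 1)) opprB addrC.
Qed.

Lemma spow_qcomm (x y : A) c (m : int) : y * x = c *: (x * y) ->
  y * star x = c^-1 *: (star x * y) ->
  exists e, y * spow x m = e *: (spow x m * y).
Proof.
move=> yx yxs.
have gen (u : A) e k : y * u = e *: (u * y) ->
    exists f, y * u ^+ k = f *: (u ^+ k * y).
  move=> yu; elim: k => [|k [f IHk]].
    by exists 1; rewrite scale1r mulr1 mul1r.
  exists (f * e).
  rewrite exprSr mulrA IHk -scalerAl -[in LHS]mulrA yu -scalerAr scalerA.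
  by rewrite !mulrA.
by case: m => k; [exact: gen yx|exact: gen yxs].
Qed.

Definition mono (k : int * int) (p : {poly K}) : A :=
  spow Z k.1 * spow W k.2 * radial p.

Lemma mono_is_zmod_morphism k : zmod_morphism (mono k).
Proof. by move=> p r; rewrite /mono rmorphB mulrBr. Qed.

Lemma monoZ k p c : c *: mono k p = mono k (c *: p).
Proof. by rewrite /mono linearZ /= -scalerAl mul1r scalerAr. Qed.

Lemma mul_mono_Z k p : exists k' p', Z * mono k p = mono k' p'.
Proof.
have [r Er] := @mul_spow Z 'X k.1 (mulZsZ _) (esym radialX).
exists (k.1 + 1, k.2), (r * p).
rewrite /mono !mulrA Er /= -(mulrA _ (radial r)) (radial_central r).
by rewrite rmorphM /= !mulrA.
Qed.

Lemma mul_mono_Zs k p : exists k' p', star Z * mono k p = mono k' p'.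
Proof.
have [r Er] := @mul_spow_star Z 'X k.1 (mulZsZ _) (esym radialX).
exists (k.1 - 1, k.2), (r * p).
rewrite /mono !mulrA Er /= -(mulrA _ (radial r)) (radial_central r).
by rewrite rmorphM /= !mulrA.
Qed.

Lemma mul_mono_W k p : exists k' p', W * mono k p = mono k' p'.
Proof.
have [r Er] := @mul_spow W (1 - 'X) k.2 (mulWsW _) (esym radial1X).
have [|e Ee] := @spow_qcomm Z W q k.1 (mulWZ _).
  by rewrite mulWZs sqV.
exists (k.1, k.2 + 1), (e *: (r * p)).
rewrite -monoZ /mono !mulrA Ee -!scalerAl -(mulrA _ W) Er /=; congr (_ *: _).
by rewrite !mulrA -(mulrA _ (radial r)) rmorphM.
Qed.

Lemma mul_mono_Ws k p : exists k' p', star W * mono k p = mono k' p'.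
Proof.
have [r Er] := @mul_spow_star W (1 - 'X) k.2 (mulWsW _) (esym radial1X).
have [||e Ee] := @spow_qcomm Z (star W) q^-1 k.1.
- by rewrite mulWsZ sqV.
- by rewrite mulWsZs invrK.
exists (k.1, k.2 - 1), (e *: (r * p)).
rewrite -monoZ /mono !mulrA Ee -!scalerAl -(mulrA _ (star W)) Er /=.
by congr (_ *: _); rewrite !mulrA -(mulrA _ (radial r)) rmorphM.
Qed.

Lemma mono_span_seq (a : A) :
  exists s : seq ((int * int) * {poly K}), a = \sum_(x <- s) mono x.1 x.2.
Proof.
pose span (a : A) := exists s : seq ((int * int) * {poly K}),
  a = \sum_(x <- s) mono x.1 x.2.
suff H : forall b, span b -> span (a * b).
  rewrite -[a]mulr1; apply: H; exists [:: ((0, 0), 1)].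
  by rewrite big_seq1 /mono rmorph1 !mulr1.
have spanD u v : span u -> span v -> span (u + v).
  by move=> [s ->] [t ->]; exists (s ++ t); rewrite big_cat.
have gen u : (forall k p, exists k' p', u * mono k p = mono k' p') ->
    forall b, span b -> span (u * b).
  move=> Hu b [s ->]; rewrite mulr_sumr.
  apply: big_ind => //; first by exists [::]; rewrite big_nil.
  move=> [k p] _; have [k' [p' ->]] := Hu k p.
  by exists [:: (k', p')]; rewrite big_seq1.
elim/sphere_ind: a => [||||c|u v Hu Hv|u v Hu Hv] b.
- exact/gen/mul_mono_Z.
- exact/gen/mul_mono_Zs.
- exact/gen/mul_mono_W.
- exact/gen/mul_mono_Ws.
- apply: gen => k p; exists k, (c *: p).
  by rewrite -scalerAl mul1r monoZ.
- by move=> Hb; rewrite mulrDl; apply: spanD; [exact: Hu|exact: Hv].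
- by move=> Hb; rewrite -mulrA; apply: Hu; exact: Hv.
Qed.

(** Collecting the terms with equal exponents is what makes the coefficient
    functional below see each exponent in one term only. *)
Lemma mono_span (a : A) : exists (s : seq (int * int)) p,
  uniq s /\ a = \sum_(k <- s) mono k (p k).
Proof.
have [s ->] := mono_span_seq a.
exists (undup (map fst s)), (fun k => \sum_(x <- s | x.1 == k) x.2).
split; first exact: undup_uniq.
pose ad k : {additive {poly K} -> A} :=
  HB.pack (mono k)
    (GRing.isZmodMorphism.Build _ _ (mono k) (@mono_is_zmod_morphism k)).
have E k : mono k (\sum_(x <- s | x.1 == k) x.2) =
    \sum_(x <- s) if x.1 == k then mono x.1 x.2 else 0.
  rewrite -big_mkcond -[mono k]/(ad k : _ -> _) raddf_sum /=.
  by apply: eq_bigr => x /eqP ->.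
under [RHS]eq_bigr do rewrite E.
rewrite exchange_big big_seq [RHS]big_seq; apply: eq_bigr => x xs.
rewrite (bigD1_seq x.1) ?undup_uniq ?mem_undup ?map_f//= eqxx big1 ?addr0//.
by move=> k kx; rewrite eq_sym (negPf kx).
Qed.

(** * Independence of the monomials and regularity *)

Local Notation lattice_fun := (int -> int -> {poly K}).

(** The left regular representation of the algebra in which |Z|^2 and |W|^2 are
    inverted, on the K[|Z|^2]-combinations of the basis Z^i W^j, (i, j) in Z^2:
    f stands for the formal sum of the Z^i W^j f(i, j).  Since there
    star Z = |Z|^2 Z^-1, it acts as the inverse shift times |Z|^2, and likewise
    for W; the powers of q come from moving W past Z^i. *)
Fixpoint act (x : sterm K) (f : lattice_fun) : lattice_fun := fun i j =>
  match x with
  | sZ => f (i - 1) j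
  | sZs => 'X * f (i + 1) j
  | sW => (q ^ i)%:P * f i (j - 1)
  | sWs => (q ^ (- i))%:P * (1 - 'X) * f i (j + 1)
  | sC c => c%:P * f i j
  | sadd x y => act x f i j + act y f i j
  | smul x y => act x (act y f) i j
  end.

Lemma act_ext x f g : f =2 g -> act x f =2 act x g.
Proof.
elim: x f g => [||||c|x IHx y IHy|x IHx y IHy] f g fg i j /=; rewrite ?fg//.
- by rewrite (IHx _ _ fg) (IHy _ _ fg).
- by apply: IHx; exact: IHy.
Qed.

Lemma act_add x f g i j :
  act x (fun i j => f i j + g i j) i j = act x f i j + act x g i j.
Proof.
elim: x f g i j => [||||c|x IHx y IHy|x IHx y IHy] f g i j //=;
  rewrite ?mulrDr//.
- by rewrite IHx IHy addrACA.
- by rewrite (act_ext _ (IHy f g)) IHx.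
Qed.

(** The variable acts centrally, as |Z|^2 does. *)
Lemma act_scale p x f i j : act x (fun i j => p * f i j) i j = p * act x f i j.
Proof.
elim: x f i j => [||||c|x IHx y IHy|x IHx y IHy] f i j //=; rewrite 1?mulrCA//.
- by rewrite IHx IHy mulrDr.
- by rewrite (act_ext _ (IHy f)) IHx.
Qed.

Lemma act_eqv x y : seqv theta x y -> forall f i j, act x f i j = act y f i j.
Proof.
have qE (i : int) : q ^ (i - 1) = q^-1 * q ^ i.
  by rewrite expfzDr ?sq_neq0// exprN1 mulrC.
have qE1 (i : int) : q ^ (i + 1) = q * q ^ i.
  by rewrite expfzDr ?sq_neq0// expr1z mulrC.
have qNE (i : int) : q ^ (- (i - 1)) = q * q ^ (- i).
  by rewrite opprB addrC -qE1.
have qNE1 (i : int) : q ^ (- (i + 1)) = q^-1 * q ^ (- i).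
  by rewrite opprD -qE.
have q0 := sq_neq0.
have c1 : q%:P * q^-1%:P = 1 :> {poly K} by rewrite -rmorphM /= divff.
elim=> {x y}.
- by [].
- by move=> x y _ IH f i j; rewrite IH.
- by move=> x y z _ IH1 _ IH2 f i j; rewrite IH1.
- by move=> x x' y y' _ IHx _ IHy f i j /=; rewrite IHx IHy.
- by move=> x x' y y' _ IHx _ IHy f i j /=; rewrite IHx; apply: act_ext.
- by move=> x y z f i j /=; rewrite addrA.
- by move=> x y f i j /=; rewrite addrC.
- by move=> x f i j /=; rewrite mul0r add0r.
- by [].
- by move=> x f i j /=; rewrite mul1r.
- by move=> x f i j /=; rewrite !mul0r.
- by [].
- by move=> x y z f i j /=; rewrite act_add.
- by move=> c d f i j /=; rewrite rmorphD mulrDl.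
- by move=> c d f i j /=; rewrite rmorphM mulrA.
- by move=> c x f i j /=; rewrite act_scale.
(* The product q q^-1 = 1 is inserted for the identity to hold with q and q^-1
   as independent variables. *)
- by move=> f i j /=; rewrite qE rmorphM /= -[LHS]mul1r -c1; ring.
- by move=> f i j /=; rewrite sqV qNE rmorphM /= -[LHS]mul1r -c1; ring.
- by move=> f i j /=; rewrite sqV qE1 rmorphM /= -[LHS]mul1r -c1; ring.
- by move=> f i j /=; rewrite qNE1 rmorphM /= -[LHS]mul1r -c1; ring.
- by move=> f i j /=; rewrite addrK subrK.
- by move=> f i j /=; rewrite addrK subrK; ring.
- move=> f i j /=; rewrite subrK mulrA mulrA -rmorphM /= -expfzDr// subrr mul1r.
  by rewrite subrK mulrBl polyCN mulN1r mul1r.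
Qed.

Definition sact (a : A) : lattice_fun -> lattice_fun := act (repr a).

Lemma sact_spi x f i j : sact (spi x) f i j = act x f i j.
Proof. by apply: act_eqv; exact: seqv_repr. Qed.

Lemma sactD a b f i j : sact (a + b) f i j = sact a f i j + sact b f i j.
Proof.
by elim/spi_ind: a => x; elim/spi_ind: b => y; rewrite -spiD !sact_spi.
Qed.

Lemma sactM a b f i j : sact (a * b) f i j = sact a (sact b f) i j.
Proof.
elim/spi_ind: a => x; elim/spi_ind: b => y; rewrite -spiM !sact_spi /=.
by apply: act_ext => k l; rewrite sact_spi.
Qed.

Lemma sactC c f i j : sact c%:A f i j = c%:P * f i j.
Proof. by rewrite -spiC sact_spi. Qed.

Lemma sact0 f i j : sact 0 f i j = 0.
Proof. by rewrite -(scale0r 1) sactC mul0r. Qed.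

Lemma sact1 f i j : sact 1 f i j = f i j.
Proof. by rewrite -(scale1r 1) sactC mul1r. Qed.

Lemma sact_radial p f i j : sact (radial p) f i j = p * f i j.
Proof.
elim/poly_ind: p f i j => [|p c IHp] f i j.
  by rewrite rmorph0 sact0 mul0r.
rewrite rmorphD rmorphM /= radialX horner_algC sactD sactM sactC IHp.
rewrite /nsq star_Z sactM !sact_spi /= sact_spi /=.
by rewrite addrNK mulrDl mulrA.
Qed.

Lemma sact_Z f i j : sact Z f i j = f (i - 1) j.
Proof. by rewrite sact_spi. Qed.
Lemma sact_Zs f i j : sact (star Z) f i j = 'X * f (i + 1) j.
Proof. by rewrite star_Z sact_spi. Qed.
Lemma sact_W f i j : sact W f i j = (q ^ i)%:P * f i (j - 1).
Proof. by rewrite sact_spi. Qed.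
Lemma sact_Ws f i j :
  sact (star W) f i j = (q ^ (- i))%:P * (1 - 'X) * f i (j + 1).
Proof. by rewrite star_W sact_spi. Qed.

Lemma sact_spow_Z m : exists2 r : {poly K}, r != 0 &
  forall f i j, sact (spow Z m) f i j = r * f (i - m) j.
Proof.
case: m => k.
- exists 1; first exact: oner_neq0.
  elim: k => [|k IHk] f i j; first by rewrite sact1 mul1r subr0.
  rewrite /= exprS sactM sact_Z IHk; congr (_ * f _ _).
  by rewrite intS opprD addrA.
- exists ('X ^+ k.+1); first by rewrite expf_neq0// polyX_eq0.
  rewrite NegzE /= opprK; elim: k.+1 => [|l IHl] f i j.
    by rewrite sact1 mul1r addr0.
  rewrite exprS sactM sact_Zs IHl exprS mulrA; congr (_ * f _ _).
  by rewrite intS addrA.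
Qed.

(** The factor depends on the row i, because W acts there by q^i. *)
Lemma sact_spow_W n i : exists2 r : {poly K}, r != 0 &
  forall f j, sact (spow W n) f i j = r * f i (j - n).
Proof.
have qi k : (q ^ k)%:P != 0 :> {poly K}.
  by rewrite polyC_eq0 expfz_neq0// sq_neq0.
case: n => k.
- exists ((q ^ i)%:P ^+ k); first by rewrite expf_neq0.
  elim: k => [|k IHk] f j; first by rewrite sact1 mul1r subr0.
  rewrite /= exprS sactM sact_W IHk exprS mulrA; congr (_ * f _ _).
  by rewrite intS opprD addrA.
- exists (((q ^ (- i))%:P * (1 - 'X)) ^+ k.+1).
    by rewrite expf_neq0// mulf_neq0// oneBX_neq0.
  rewrite NegzE /= opprK; elim: k.+1 => [|l IHl] f j.
    by rewrite sact1 mul1r addr0.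
  rewrite exprS sactM sact_Ws IHl exprS mulrA; congr (_ * f _ _).
  by rewrite intS addrA.
Qed.

(** Up to a nonzero factor depending on (i, j), the coefficient in K[|Z|^2] of
    Z^i W^j in a. *)
Definition coef (a : A) : lattice_fun :=
  sact a (fun i j => ((i == 0) && (j == 0))%:R).

Lemma coefD a b i j : coef (a + b) i j = coef a i j + coef b i j.
Proof. exact: sactD. Qed.

Lemma coef_radialM p a i j : coef (radial p * a) i j = p * coef a i j.
Proof. by rewrite /coef sactM sact_radial. Qed.

Lemma coef_mono k : exists2 r : {poly K}, r != 0 &
  forall p i j, coef (mono k p) i j = ((i, j) == k)%:R * r * p.
Proof.
have [r r0 Er] := sact_spow_Z k.1.
case: k r r0 Er => m n /= r r0 Er.
have [s s0 Es] := sact_spow_W n 0.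
exists (r * s); first exact: mulf_neq0.
move=> p i j; rewrite /coef /mono sactM sactM Er /= xpair_eqE.
have [->|im] := eqVneq i m; last first.
  have [t _ ->] := sact_spow_W n (i - m).
  by rewrite sact_radial subr_eq0 (negPf im) /= !mulr0 !mul0r.
by rewrite subrr Es sact_radial eqxx /= subr_eq0; ring.
Qed.

Lemma coef_sum (I : eqType) (s : seq I) (G : I -> A) i j :
  coef (\sum_(k <- s) G k) i j = \sum_(k <- s) coef (G k) i j.
Proof.
elim: s => [|k s IHs]; first by rewrite !big_nil /coef sact0.
by rewrite !big_cons coefD IHs.
Qed.

(** At the exponent k of one of its monomials, a has as coefficient a nonzero
    multiple of the polynomial attached to k. *)
Lemma coef_inj0 a : (forall i j, coef a i j = 0) -> a = 0.
Proof.
have [s [p [us ->]]] := mono_span a => c0.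
rewrite big_seq big1// => k ks.
suff -> : p k = 0 by rewrite /mono rmorph0 mulr0.
have := c0 k.1 k.2; rewrite coef_sum (bigD1_seq k)//=.
rewrite big1 => [|l lk]; last first.
  have [r _ ->] := coef_mono l.
  by rewrite -surjective_pairing eq_sym (negPf lk) !mul0r.
have [r r0 ->] := coef_mono k.
rewrite addr0 -surjective_pairing eqxx mul1r => /eqP.
by rewrite mulf_eq0 (negPf r0) => /eqP.
Qed.

(** Multiplication by p(|Z|^2) multiplies all coefficients by p, in the domain
    K[t]. *)
Lemma radial_mul_eq0 p a : p != 0 -> radial p * a = 0 -> a = 0.
Proof.
move=> p0 pa; apply: coef_inj0 => i j; apply: (mulfI p0).
by rewrite -coef_radialM pa mulr0 /coef sact0.
Qed.

Lemma radial_neq0 p : p != 0 -> radial p != 0.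
Proof.
move=> p0; apply/eqP => Pp; have := oner_neq0 A.
by rewrite (@radial_mul_eq0 p 1 p0) ?eqxx// Pp mul0r.
Qed.

Lemma radial_lreg p : p != 0 -> GRing.lreg (radial p).
Proof.
move=> p0 a b /eqP; rewrite -subr_eq0 -mulrBr => /eqP.
by move/(radial_mul_eq0 p0)/eqP; rewrite subr_eq0 => /eqP.
Qed.

Lemma radial_rreg p : p != 0 -> GRing.rreg (radial p).
Proof. by move=> p0 a b; rewrite -!(radial_central p); exact: radial_lreg. Qed.

End SphereAlgebra.

(** * The three derivations *)

Section FrameDerivations.
Variables (R : realType) (theta : R).
Local Notation K := R[i].
Local Notation A := (sphere3 theta).
Local Notation radial := (horner_alg (nsq (Z : A))).

Lemma der_eq0 (d : A -> A) : hermitian_derivation d ->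
  d Z = 0 -> d W = 0 -> forall a, d a = 0.
Proof.
move=> dH dZ dW; elim/sphere_ind => [||||c|a b da db|a b da db] //.
- by rewrite der_star// dZ star0.
- by rewrite der_star// dW star0.
- by rewrite derZ// der1// scaler0.
- by rewrite derD// da db addr0.
- by rewrite derM// da db mul0r mulr0 addr0.
Qed.

Lemma lie_hermitian (d1 d2 : A -> A) : hermitian_derivation d1 ->
  hermitian_derivation d2 -> hermitian_derivation (lie d1 d2).
Proof.
move=> H1 H2; rewrite /lie; split; first split.
- move=> c a b; rewrite !(derD H1, derD H2, derZ H1, derZ H2) scalerBr.
  by rewrite opprD addrACA.
- move=> a b; rewrite !(derM H1, derM H2, derD H1, derD H2).
  rewrite mulrBl mulrBr [d2 (d1 a) * b + _ + _]addrACA opprD addrACA.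
  by congr (_ + _); rewrite opprD addrACA subrr ?addr0 ?add0r.
- by move=> a; rewrite (der_star H2) (der_star H1) (der_star H1) (der_star H2)
    -starB starK.
Qed.

Variable d : 'I_3 -> A -> A.
Hypothesis dH : forall a, hermitian_derivation (d a).
Hypotheses (d1Z : d ix1 Z = 'i%C *: Z) (d1W : d ix1 W = 0)
  (d2Z : d ix2 Z = 0) (d2W : d ix2 W = 'i%C *: W)
  (d3Z : d ix3 Z = Z * nsq W) (d3W : d ix3 W = - (W * nsq Z)).

Lemma frame_der_nsqZ a : d a (nsq Z) = radial (frame_speed _ a).
Proof.
have hermW : star (nsq W) = nsq W :> A by rewrite /nsq starM starK.
elim/ord3_ind: a;
  rewrite {1}/nsq (derM (dH _)) (der_star (dH _)) /frame_speed /=.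
- rewrite d1Z starZ -scalerAl -scalerAr -scalerDl rmorph0.
  by rewrite complexiE conjCi subrr scale0r.
- by rewrite d2Z star0 mul0r mulr0 addr0 rmorph0.
- have E : Z * (nsq W * star Z) = radial ('X * (1 - 'X)).
    by rewrite -radial1X (radial_central (1 - 'X)) mulrA rmorphM /= radialX.
  by rewrite d3Z starM hermW -mulrA E -raddfD -mulr2n mulr_natl.
Qed.

Lemma frame_der_radial a p : d a (radial p) = radial (p^`() * frame_speed _ a).
Proof.
rewrite (der_horner_alg (dH a) p (frame_der_nsqZ a) (@nsqZ_central R theta)).
by rewrite rmorphM.
Qed.

(** Only the values on Z and W matter.  There the brackets reduce to the
    derivatives of |Z|^2, which vanish along the first two derivations. *)
Lemma lie_frame a b : lie (d a) (d b) = fun=> 0.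
Proof.
have [dz1 dz2] : d ix1 (nsq Z) = 0 /\ d ix2 (nsq Z) = 0.
  by rewrite !frame_der_nsqZ !rmorph0.
have dw c : d c (nsq W) = - d c (nsq Z).
  by rewrite nsqW_sphere (derB (dH c)) (der1 (dH c)) sub0r.
have dzW c : d c (W * nsq Z) = d c W * nsq Z + W * d c (nsq Z).
  exact: derM (dH c) _ _.
have dZw c : d c (Z * nsq W) = d c Z * nsq W + Z * d c (nsq W).
  exact: derM (dH c) _ _.
apply: funext; apply: der_eq0; first exact: lie_hermitian.
  rewrite /lie; elim/ord3_ind: a; elim/ord3_ind: b;
  by rewrite ?(d1Z, d2Z, d3Z) ?subrr// ?(derZ (dH _), der0 (dH _)) ?dZw
    ?(d1Z, d2Z, d3Z) ?dw ?(dz1, dz2) ?(oppr0, mulr0, mul0r, scaler0, addr0)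
    -?scalerAl ?subrr.
rewrite /lie; elim/ord3_ind: a; elim/ord3_ind: b;
by rewrite ?(d1W, d2W, d3W) ?subrr// ?(derZ (dH _), der0 (dH _), derN (dH _))
  ?dzW ?(d1W, d2W, d3W) ?(dz1, dz2)
  ?(mulr0, mul0r, scaler0, addr0, oppr0) ?scalerN -?scalerAl ?subrr.
Qed.

End FrameDerivations.

(** * The Levi-Civita connection and its curvature *)

Section Geometry.
Variables (R : realType) (theta : R).
Local Notation K := R[i].
Local Notation A := (sphere3 theta).
Local Notation M := (sphere3_mod theta).
Local Notation radial := (horner_alg (nsq (Z : A))).

Lemma frame_spans (U : M) : exists u : 'I_3 -> A, U = \sum_a E a <* u a.
Proof.
have [u Eu] := asboolP _ (valP U); exists u; apply: val_inj.
by rewrite Eu raddf_sum.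
Qed.

Lemma hmx_poly a b : hmx a b = radial (metric_poly K a b).
Proof.
rewrite /hmx /metric_poly !mxE raddfMn; congr (_ *+ _).
by elim/ord3_ind: a => /=; rewrite ?rmorphM /= ?radial1X ?radialX.
Qed.

Lemma frame_delta a : E a = \sum_b E b <* (a == b)%:R :> M.
Proof.
rewrite (bigD1 a)//= eqxx ract1 big1 ?addr0// => b ba.
by rewrite eq_sym (negPf ba) ract0.
Qed.

Variable h : M -> M -> A.
Hypothesis hE : forall u v : 'I_3 -> A,
    h (\sum_a E a <* u a) (\sum_a E a <* v a) =
    \sum_a \sum_b star (u a) * hmx a b * v b.

Lemma h_frame a b : h (E a) (E b) = radial (metric_poly K a b).
Proof.
rewrite frame_delta [E b]frame_delta hE -hmx_poly.
rewrite (bigD1 a)//= [X in _ + X]big1 => [|c ca]; last first.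
  by rewrite big1// => e _; rewrite eq_sym (negPf ca) star0 !mul0r.
rewrite (bigD1 b)//= [X in _ + X + _]big1 => [|c cb]; last first.
  by rewrite [b == c]eq_sym (negPf cb) mulr0.
by rewrite !eqxx star_nat mul1r mulr1 !addr0.
Qed.

Hypothesis h_metric : metric h.

Lemma h_sum U u : h U (\sum_a E a <* u a) = \sum_a h U (E a) * u a.
Proof.
have hf := h_metric.1.
have h0 : h U 0 = 0 by apply: (addrI (h U 0)); rewrite -(hform_addr hf) !addr0.
rewrite (big_morph _ (hform_addr hf U) h0); apply: eq_bigr => a _.
exact: hform_ract.
Qed.

(** The form sees U - V only through its products with the generators of the
    module, so non-degeneracy can be tested on the frame. *)
Lemma frame_ext U V : (forall c, h (E c) U = h (E c) V) -> U = V.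
Proof.
move=> UV; have hf := h_metric.1.
have hD U' V' W : h (U' + V') W = h U' W + h V' W.
  by rewrite -(hform_star hf) (hform_addr hf) starD !(hform_star hf).
have hN U' W : h (- U') W = - h U' W.
  apply: (addIr (h U' W)); rewrite -hD !addNr.
  by apply: (addrI (h 0 W)); rewrite -hD !addr0.
apply/eqP; rewrite -subr_eq0; apply/eqP; apply: h_metric.2 => W.
have [w ->] := frame_spans W; rewrite h_sum big1// => c _.
rewrite hD hN -!(hform_star hf (E c)) UV subrr mul0r//.
Qed.

Variable d : 'I_3 -> A -> A.
Hypothesis dH : forall a, hermitian_derivation (d a).
Hypotheses (d1Z : d ix1 Z = 'i%C *: Z) (d1W : d ix1 W = 0)
  (d2Z : d ix2 Z = 0) (d2W : d ix2 W = 'i%C *: W)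
  (d3Z : d ix3 Z = Z * nsq W) (d3W : d ix3 W = - (W * nsq Z)).
Variables (phi : (A -> A) -> M) (nabla : (A -> A) -> M -> M).
Hypothesis phiE : forall a, phi (d a) = E a.
Local Notation g := (lie_generated (range d)).
Hypothesis calculus : pseudo_Riemannian_calculus g h phi nabla.

Lemma frame_in_g a : g (d a).
Proof. by move=> G _; apply; exists a. Qed.

Lemma frame_in_Mphi a : (phi @` g) (E a).
Proof. by exists (d a); [exact: frame_in_g|exact: phiE]. Qed.

Let d_radial a p : d a (radial p) = radial (p^`() * frame_speed _ a).
Proof. exact: frame_der_radial. Qed.

Let lie0 a b : lie (d a) (d b) = fun=> 0.
Proof. exact: lie_frame. Qed.

Lemma zero_in_g : g (fun=> 0).
Proof. by have [_ ? _ _ _] := rmc_lie (prc_rmc calculus). Qed.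

Lemma real_linear0 (f : (A -> A) -> M) : real_linear_on g f -> f (fun=> 0) = 0.
Proof.
move=> [fD _]; have := fD _ _ zero_in_g zero_in_g.
have -> : (fun a : A => 0 + 0 : A) = fun=> 0.
  by apply: funext => a; rewrite addr0.
by move=> E0; apply: (addrI (f (fun=> 0))); rewrite addr0 -E0.
Qed.

Lemma frame_torsion a b : nabla (d a) (E b) = nabla (d b) (E a).
Proof.
have := prc_torsion calculus (frame_in_g a) (frame_in_g b).
rewrite lie0 !phiE real_linear0 ?subr0; last first.
  exact: rmc_linear (prc_rmc calculus).
by move/eqP; rewrite subr_eq0 => /eqP.
Qed.

(** Since h(nabla_a E_b, E_k) is hermitian it equals c a b k below, so
    compatibility reads d_x h_yz = c x y z + c x z y, while vanishing torsion
    makes c symmetric in its first two indices: the sum of three such equations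
    isolates 2 c a b k. *)
Lemma frame_koszul a b k :
  h (E k) (nabla (d a) (E b)) =
  radial (metric_poly K k k * christoffel K a b k).
Proof.
pose c a b k := h (E k) (nabla (d a) (E b)).
have hf := h_metric.1.
have compat x y z :
    radial ((metric_poly K y z)^`() * frame_speed K x) = c x y z + c x z y.
  rewrite -d_radial -h_frame (prc_compat calculus _ _ (frame_in_g x)) /c.
  rewrite -[h (E z) _](hform_star hf).
  have herm := prc_herm calculus (frame_in_g x).
  by rewrite (herm _ _ (frame_in_Mphi y) (frame_in_Mphi z)).
have tors x y z : c x y z = c y x z by rewrite /c frame_torsion.
have two : (2%:R : {poly K}) != 0 by rewrite -polyC_natr polyC_eq0 pnatr_eq0.
apply: (radial_lreg two); rewrite -[RHS]rmorphM -koszul.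
rewrite [RHS]rmorphB [X in _ = X - _]rmorphD /= !compat.
rewrite rmorph_nat mulr_natl mulr2n.
rewrite (tors k a b) (tors k b a) (tors b a k) -/(c a b k).
move: (c a b k) (c a k b) (c b k a) => x y z.
by rewrite addrACA addrK.
Qed.

Lemma frame_connection a b :
  nabla (d a) (E b) = \sum_k E k <* radial (christoffel K a b k).
Proof.
apply: frame_ext => c; rewrite frame_koszul h_sum (bigD1 c)//= big1 ?addr0.
  by rewrite h_frame -rmorphM.
move=> k kc; rewrite h_frame /metric_poly eq_sym (negPf kc) mulr0n rmorph0.
by rewrite mul0r.
Qed.

Lemma connection_poly a (u : 'I_3 -> {poly K}) :
  nabla (d a) (\sum_c E c <* radial (u c)) =
  \sum_k E k <* radial ((u k)^`() * frame_speed K a +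
     \sum_c christoffel K a c k * u c).
Proof.
have cn := prc_conn calculus; have ga := frame_in_g a.
have n0 : nabla (d a) 0 = 0.
  by apply: (addrI (nabla (d a) 0)); rewrite -(conn_add cn)// !addr0.
rewrite (big_morph _ (fun U V => conn_add cn U V ga) n0).
under eq_bigr do rewrite (conn_leibniz cn _ _ ga) d_radial frame_connection.
rewrite big_split /= addrC.
under [RHS]eq_bigr do rewrite rmorphD ractDr rmorph_sum ract_sumr.
rewrite big_split /=; congr (_ + _).
rewrite exchange_big; apply: eq_bigr => c _ /=.
rewrite ract_suml; apply: eq_bigr => k _.
by rewrite ractA -rmorphM.
Qed.

Lemma frame_curvature a b c :
  curvature nabla (d a) (d b) (E c) =
  E a <* radial (metric_poly K b c) - E b <* radial (metric_poly K a c).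
Proof.
have nabla0 := real_linear0 (conn_linear (prc_conn calculus) (E c)).
rewrite /curvature lie0 nabla0 subr0.
rewrite !frame_connection !connection_poly.
rewrite -sumrB.
transitivity (\sum_k E k <* radial (riemann_poly K a b c k)).
  by apply: eq_bigr => k _; rewrite -ractB -rmorphB.
have Edelta x (p : {poly K}) :
    E x <* radial p = \sum_k E k <* radial ((x == k)%:R * p).
  rewrite [E x]frame_delta ract_suml; apply: eq_bigr => k _.
  by rewrite ractA rmorphM rmorph_nat.
rewrite !Edelta -sumrB; apply: eq_bigr => k _.
by rewrite riemann_constant rmorphB ractB.
Qed.

Lemma frame_curv_comp a b p q :
  curv_comp h phi nabla d a b p q =
  radial (riemann_comp K a b p q).
Proof.
have hf := h_metric.1.
rewrite /curv_comp !phiE frame_curvature (hform_addr hf) -ractN.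
by rewrite !(hform_ract hf) !h_frame mulrN -!rmorphM -rmorphB.
Qed.

Lemma metric_compE a b : metric_comp h phi d a b = radial (metric_poly K a b).
Proof. by rewrite mxE !phiE h_frame. Qed.

Lemma scalar_curvature_contraction hinv H : pseudo_inverse h phi d hinv H ->
  \sum_a \sum_b \sum_p \sum_q
    hinv a b * curv_comp h phi nabla d a p b q * hinv p q = H * 6%:R * H.
Proof.
move=> [_ _ _ ginvg gginv].
rewrite mulr_natr mulrnAl -[6%N]/(3 * 3.-1)%N.
rewrite -(constant_curvature_trace _ _ ginvg gginv) => [|i j a|i j].
- apply: eq_bigr => a _; apply: eq_bigr => b _; apply: eq_bigr => p _.
  apply: eq_bigr => q _.
  by rewrite frame_curv_comp !metric_compE rmorphB !rmorphM.
- by rewrite metric_compE; exact: radial_central.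
- by rewrite !metric_compE metric_polyC.
Qed.

(** Multiplying the inverse of the diagonal metric by |Z|^2 |W|^2 clears all
    denominators. *)
Lemma pseudo_inverse_exists : exists hinv H, pseudo_inverse h phi d hinv H.
Proof.
pose gp : 'M[{poly K}]_3 := \matrix_(a, b) metric_poly K a b.
pose c : 'rV[{poly K}]_3 := \row_a nth 0 [:: 1 - 'X; 'X; 1] a.
pose H : {poly K} := 'X * (1 - 'X).
have gE : metric_comp h phi d = map_mx radial gp.
  by apply/matrixP => a b; rewrite metric_compE !mxE.
have diag : diag_mx c *m gp = H%:M /\ gp *m diag_mx c = H%:M.
  have -> : gp = diag_mx (\row_a metric_poly K a a).
    by apply/matrixP => a b; rewrite !mxE /metric_poly eqxx mulr1n.
  rewrite !mulmx_diag; split; apply/matrixP => a b; rewrite !mxE;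
  congr (_ *+ _);
  by elim/ord3_ind: a; rewrite /metric_poly /H /= ?mulr1n; ring.
have H0 : H != 0 by rewrite mulf_neq0 ?polyX_eq0 ?oneBX_neq0.
exists (map_mx radial (diag_mx c)), (radial H); split.
- rewrite /Defs.hermitian rmorphM /= radial1X radialX starM /nsq !starM !starK.
  exact: esym (nsqZ_central _).
- exact: radial_lreg.
- exact: radial_rreg.
- by rewrite gE -map_mxM diag.1 map_scalar_mx.
- by rewrite gE -map_mxM diag.2 map_scalar_mx.
Qed.

End Geometry.

(** * Curvature and scalar curvature of the noncommutative 3-sphere *)

Local Notation radial := (horner_alg (nsq Z)).

Theorem proposition6p6 (R : realType) (theta : R)
  (d : 'I_3 -> sphere3 theta -> sphere3 theta)
  (d_hder : forall a, hermitian_derivation (d a))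
  (d1Z : d ix1 Z = 'i%C *: Z) (d1W : d ix1 W = 0)
  (d2Z : d ix2 Z = 0) (d2W : d ix2 W = 'i%C *: W)
  (d3Z : d ix3 Z = Z * nsq W) (d3W : d ix3 W = - (W * nsq Z))
  (h : sphere3_mod theta -> sphere3_mod theta -> sphere3 theta)
  (hE : forall u v : 'I_3 -> sphere3 theta,
    h (\sum_a E a <* u a) (\sum_a E a <* v a) =
    \sum_a \sum_b star (u a) * hmx a b * v b)
  (phi : (sphere3 theta -> sphere3 theta) -> sphere3_mod theta)
  (phiE : forall a, phi (d a) = E a)
  (nabla : (sphere3 theta -> sphere3 theta) ->
    sphere3_mod theta -> sphere3_mod theta)
  (calculus :
    real_pseudo_Riemannian_calculus (lie_generated (range d)) h phi nabla) :
  let Rop := fun a b => curvature nabla (d a) (d b) in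
  let Rc := curv_comp h phi nabla d in
  (* curvature operator *)
  ((Rop ix1 ix2 (E ix1) = - (E ix2 <* nsq Z) /\
    Rop ix1 ix2 (E ix2) = E ix1 <* nsq W /\
    Rop ix1 ix2 (E ix3) = 0) /\
   (Rop ix1 ix3 (E ix1) = - (E ix3 <* nsq Z) /\
    Rop ix1 ix3 (E ix2) = 0 /\
    Rop ix1 ix3 (E ix3) = E ix1 <* (nsq Z * nsq W)) /\
   (Rop ix2 ix3 (E ix1) = 0 /\
    Rop ix2 ix3 (E ix2) = - (E ix3 <* nsq W) /\
    Rop ix2 ix3 (E ix3) = E ix2 <* (nsq Z * nsq W))) /\
  (* nonzero curvature components *)
  ((forall a b p q, Rc a b p q = - Rc a b q p /\
      Rc a b p q = - Rc b a p q /\ Rc a b p q = Rc p q a b) /\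
   (Rc ix1 ix2 ix1 ix2 = nsq Z * nsq W /\
    Rc ix1 ix3 ix1 ix3 = nsq Z ^+ 2 * nsq W /\
    Rc ix2 ix3 ix2 ix3 = nsq Z * nsq W ^+ 2) /\
   (forall a b p q, Rc a b p q <> 0 <->
      curv_sym ix1 ix2 ix1 ix2 a b p q \/
      curv_sym ix1 ix3 ix1 ix3 a b p q \/
      curv_sym ix2 ix3 ix2 ix3 a b p q)) /\
  (* scalar curvature *)
  ((exists hinv H S, pseudo_inverse h phi d hinv H /\
      scalar_curvature h phi nabla d hinv H S) /\
   (forall hinv H S, pseudo_inverse h phi d hinv H ->
      scalar_curvature h phi nabla d hinv H S -> S = 6%:R)).
Proof.
move=> Rop Rc.
have prc := calculus.1; have hm := rmc_metric (prc_rmc prc).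
have RopE a b c : Rop a b (E c) =
    E a <* radial (metric_poly _ b c) - E b <* radial (metric_poly _ a c).
  exact: (frame_curvature hE hm d_hder d1Z d1W d2Z d2W d3Z d3W phiE prc).
have RcE a b p q : Rc a b p q = radial (riemann_comp _ a b p q).
  exact: (frame_curv_comp hE hm d_hder d1Z d1W d2Z d2W d3Z d3W phiE prc).
have contraction := scalar_curvature_contraction hE hm d_hder d1Z d1W d2Z d2W
  d3Z d3W phiE prc.
have sym a b p q : Rc a b p q = - Rc a b q p /\
    Rc a b p q = - Rc b a p q /\ Rc a b p q = Rc p q a b.
  rewrite !RcE -!rmorphN /riemann_comp; split; [|split]; congr (radial _).
  - by rewrite opprB.
  - rewrite (metric_polyC _ b p) (metric_polyC _ b q) (metric_polyC _ q a).
    by rewrite (metric_polyC _ p a); ring.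
  - by rewrite (metric_polyC _ p a) (metric_polyC _ b q); ring.
have PZ := radialX theta; have PW := radial1X theta.
have PZW := rmorphM (horner_alg (nsq (Z : sphere3 theta))) 'X (1 - 'X).
rewrite /= PZ PW in PZW.
have comps : Rc ix1 ix2 ix1 ix2 = nsq Z * nsq W /\
    Rc ix1 ix3 ix1 ix3 = nsq Z ^+ 2 * nsq W /\
    Rc ix2 ix3 ix2 ix3 = nsq Z * nsq W ^+ 2.
  rewrite !RcE /riemann_comp /metric_poly /= !mulr1n !mulr0n ?(mul0r, subr0).
  rewrite !rmorphM /= PZ PW !expr2; split=> //; split; first exact: mulrA.
  by rewrite [RHS]mulrA (nsqZ_central (nsq W)) -mulrA (nsqZ_central (nsq W)).
split; [|split; [split; [|split]|split]] => //.
- have off a b : a != b -> radial (metric_poly R[i] a b) = 0 :> sphere3 theta.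
    by move=> /negPf ab; rewrite /metric_poly ab mulr0n rmorph0.
  have [h11 h22 h33] : [/\
      radial (metric_poly R[i] ix1 ix1) = nsq Z :> sphere3 theta,
      radial (metric_poly R[i] ix2 ix2) = nsq W :> sphere3 theta &
      radial (metric_poly R[i] ix3 ix3) = nsq Z * nsq W :> sphere3 theta].
    by rewrite /metric_poly !eqxx !mulr1n /= PZ PW PZW.
  by rewrite !RopE h11 h22 h33 !off// !ract0 !sub0r !subr0 oppr0.
- move=> a b p q; split.
    move=> Rn0; apply: (@riemann_comp_support R[i]).
    by apply/eqP => r0; apply: Rn0; rewrite RcE r0 rmorph0.
  (* Each symmetry changes a component at most by a sign. *)
  have base i j : Rc i j i j <> 0 ->
      forall a b p q, curv_sym i j i j a b p q -> Rc a b p q <> 0.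
    move=> ij a' b' p' q'; elim=> // {}a' {}b' {}p' {}q' _ IH.
    - by move=> R0; apply: IH; have [-> _] := sym a' b' p' q'; rewrite R0 oppr0.
    - by move=> R0; apply: IH; have [_ [-> _]] := sym a' b' p' q';
      rewrite R0 oppr0.
    - by have [_ [_ <-]] := sym a' b' p' q'.
  have n0 i j : riemann_comp R[i] i j i j != 0 -> Rc i j i j <> 0.
    by move=> r0; rewrite RcE; apply/eqP; exact: (radial_neq0 theta r0).
  have X0 : 'X != 0 :> {poly R[i]} by rewrite polyX_eq0.
  have X1 := oneBX_neq0 R[i].
  by case=> [|[|]]; apply: base; apply: n0;
    rewrite /riemann_comp /metric_poly /= ?mulr1n ?mulr0n ?(mul0r, subr0)
       !mulf_neq0.
- have [hinv [H inv]] := pseudo_inverse_exists hE phiE.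
  by exists hinv, H, 6%:R; split=> //; exact: contraction.
- move=> hinv H S inv; rewrite /scalar_curvature (contraction _ _ inv) => HS.
  by case: inv => _ Hl Hr _ _; apply/Hl/Hr.
Qed.
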